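(* Let $LFK$ denote the set of long flat virtual knot diagrams and $LVK$ the set of long virtual knot diagrams. For a long flat virtual knot diagram $S$, let $A(S)$ be the ascending long virtual knot diagram associated with $S$. Then the mapping $A: LFK \longrightarrow LVK$ is well-defined on the corresponding isotopy classes of diagrams (if $S$ and $T$ are isotopic long flat virtual knot diagrams, then $A(S)$ and $A(T)$ are isotopic long virtual knot diagrams), and the induced map from isotopy classes of long flat virtual knots to isotopy classes of long virtual knots is injective. Hence long flat virtual knots embed in the class of long virtual knots.
   Context: A virtual diagram is a generic immersed planar curve diagram each of whose double points is either a classical crossing (with over/under information) or a virtual crossing (drawn with a small circle, neither over nor under). Virtual isotopy is the equivalence relation generated by planar isotopy, the usual Reidemeister moves I, II, III on classical crossings, and the detour move: an arc of the diagram containing only a consecutive sequence of virtual crossings (possibly none) can be excised and replaced by any other generic arc in the plane with the same endpoints, all of whose transversal intersections with the rest of the diagram (and with itself) are declared to be virtual crossings. The ''forbidden moves'' (moving an arc with two consecutive classical over-crossings, or two consecutive classical under-crossings, past a virtual crossing) are not allowed. Equivalently, virtual diagrams up to virtual isotopy are oriented signed Gauss codes up to abstract Reidemeister moves. A flat virtual diagram is defined the same way, except that each classical crossing is replaced by a flat crossing, i.e. an undecorated transversal double point without over/under information. Isotopy (equivalence) of flat virtual diagrams is generated by planar isotopy, flat Reidemeister moves I, II, III (the Reidemeister moves on flat crossings with over/under information ignored), and the detour move for consecutive sequences of virtual crossings. The flat analogues of the forbidden moves are not allowed. A long (flat) virtual knot diagram is a one-component $1$-$1$ tangle diagram of this kind: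 a generic immersed line in the plane with one input end on the left and one output end on the right, traversed from left to right, where the ends are fixed and the moves above are applied away from the ends at infinity. Ascending diagram: given a long flat virtual diagram $S$, $A(S)$ is obtained by traversing $S$ from its left end to its right end and turning each flat crossing into a classical crossing in such a way that one passes under each crossing (on the first visit) before passing over that crossing (on the second visit). Virtual crossings are unchanged. *)

(* Defs.v *)
From Stdlib Require Export Relation_Operators.
From HB Require Import structures.
From mathcomp Require Export all_boot all_order all_algebra.
From mathcomp Require Export all_classical all_reals all_analysis.

Set Implicit Arguments.
Unset Strict Implicit.
Unset Printing Implicit Defensive.

Import Order.TTheory GRing.Theory Num.Theory.
Import numFieldNormedType.Exports.

Local Open Scope classical_set_scope.
Local Open Scope ring_scope.

(** * Smooth maps *)

(* In finite dimension, the iterated directional derivatives in all directions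
   existing and being continuous is the usual notion of a C^k map. *)
Fixpoint Ck (R : realType) (V W : normedModType R) (k : nat) (f : V -> W) :
    Prop :=
  continuous f /\
  if k is k'.+1 then
    forall v : V, (forall x, derivable f x v) /\ Ck k' ('D_v f)
  else True.

Definition smooth (R : realType) (V W : normedModType R) (f : V -> W) : Prop :=
  forall k, Ck k f.

Definition diffeomorphism (R : realType) (V W : normedModType R)
    (f : V -> W) : Prop :=
  smooth f /\ exists g : W -> V, [/\ smooth g, cancel f g & cancel g f].

Definition plane (R : realType) : normedModType R := (R^o * R^o)%type.

Definition disk (R : realType) (B : set (plane R)) : Prop :=
  exists psi : plane R -> plane R,
    diffeomorphism psi /\
    B = psi @` [set x : plane R | x.1 ^+ 2 + x.2 ^+ 2 <= 1].

(* Time ranges over the whole line so that no boundary is needed: an isotopy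
   over [0, 1] extends once its time is made constant near 0 and 1. *)
Definition ambient_isotopy (R : realType) (h : R^o -> plane R -> plane R) :
    Prop :=
  [/\ smooth (fun p : (R^o * plane R)%type => h p.1 p.2),
      forall u, diffeomorphism (h u),
      h 0 = id &
      exists M : R, forall u x, M < `|x| -> h u x = x].

(** * Long diagrams *)

(* A generic immersed line, oriented by its parameter, which is the standard
   horizontal line outside a compact set.  There are only finitely many double
   points, by transversality and compactness. *)
Definition long_generic_curve (R : realType) (c : R^o -> plane R) : Prop :=
  [/\ smooth c,
      forall t, derive1 c t != 0,
      exists M : R, forall t, M < `|t| -> c t = (t, 0),
      forall s t, s < t -> c s = c t ->
        let u := derive1 c s in let v := derive1 c t in
        u.1 * v.2 - u.2 * v.1 != 0 &
      forall s t u, s < t -> t < u -> c s = c t -> c t <> c u].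

(* K is the type of decorations of a non-virtual crossing.  A crossing is
   given by its two parameters s < t, and [kind s t] is [None] if the crossing
   is virtual and [Some k] if it is non-virtual with decoration k.  The value
   of [kind s t] is irrelevant when s < t is not a crossing; diagrams that
   differ only in these values are identified by [planar_isotopy] below. *)
Record long_diagram (R : realType) (K : Type) := LongDiagram {
  curve : R^o -> plane R;
  kind : R -> R -> option K;
  curve_generic : long_generic_curve curve
}.

Definition crossing (R : realType) (K : Type) (D : long_diagram R K)
    (s t : R) : Prop := s < t /\ curve D s = curve D t.

Definition crossings_in (R : realType) (K : Type) (D : long_diagram R K)
    (B : set (plane R)) : set (R * R) :=
  [set p | crossing D p.1 p.2 /\ B (curve D p.1)].

Definition long_flat_virtual_diagram (R : realType) := long_diagram R unit.

(* Which of the two strands of a classical crossing is the upper one: the one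
   traversed first or the one traversed second. *)
Inductive upper_strand := FirstOver | SecondOver.

Definition long_virtual_diagram (R : realType) := long_diagram R upper_strand.

(** * Moves *)

(* In the Reidemeister moves, each arc inside the disk has a height, and
   [above k b] says that a crossing decorated by k is allowed when the strand
   traversed first is the higher one (b = true) or the lower one (b = false).
   Flat crossings are always allowed. *)
Definition classical_above (k : upper_strand) (b : bool) : Prop :=
  k = if b then FirstOver else SecondOver.

Definition flat_above (k : unit) (b : bool) : Prop := True.

(* The second component allows a change of parametrization. *)
Definition planar_isotopy (R : realType) (K : Type) (D D' : long_diagram R K) :
    Prop :=
  exists (h : R^o -> plane R -> plane R) (r : R^o -> R^o),
    [/\ ambient_isotopy h,
        diffeomorphism r /\ (forall s t, s < t -> r s < r t),
        forall t, curve D' (r t) = h 1 (curve D t) &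
        forall s t, crossing D s t -> kind D' (r s) (r t) = kind D s t].

Definition detour (R : realType) (K : Type) (D D' : long_diagram R K) : Prop :=
  exists a b : R,
    [/\ a < b,
        forall t, t \notin `]a, b[ -> curve D' t = curve D t,
        forall s t, crossing D s t -> (s \in `[a, b]) || (t \in `[a, b]) ->
          kind D s t = None,
        forall s t, crossing D' s t -> (s \in `[a, b]) || (t \in `[a, b]) ->
          kind D' s t = None &
        forall s t, crossing D s t -> s \notin `[a, b] -> t \notin `[a, b] ->
          kind D' s t = kind D s t].

(* D and D' agree outside the disk B, and U is the set of parameters of the
   arcs inside B. *)
Definition agree_outside (R : realType) (K : Type) (B : set (plane R))
    (U : set R) (D D' : long_diagram R K) : Prop :=
  [/\ disk B,
      curve D @^-1` B = U,
      curve D' @^-1` B = U,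
      forall t, ~ U t -> curve D' t = curve D t &
      forall s t, crossing D s t -> ~ B (curve D s) ->
        kind D' s t = kind D s t].

(* One arc in the disk, which gets a kink. *)
Definition reidemeister1 (R : realType) (K : Type) (D D' : long_diagram R K) :
    Prop :=
  exists (B : set (plane R)) (a b s t : R) (k : K),
    [/\ a < b,
        agree_outside B `[a, b] D D',
        crossings_in D B = set0,
        crossings_in D' B = [set (s, t)] &
        kind D' s t = Some k].

(* Two disjoint arcs in the disk; one of them is pushed across the other. *)
Definition reidemeister2 (R : realType) (K : Type) (above : K -> bool -> Prop)
    (D D' : long_diagram R K) : Prop :=
  exists (B : set (plane R)) (a1 b1 a2 b2 s t s' t' : R) (k k' : K) (b : bool),
    [/\ [/\ a1 < b1, b1 < a2, a2 < b2 &
            agree_outside B (`[a1, b1] `|` `[a2, b2]) D D'],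
        crossings_in D B = set0,
        crossings_in D' B = [set (s, t); (s', t')],
        [/\ s \in `[a1, b1], t \in `[a2, b2], s' \in `[a1, b1],
            t' \in `[a2, b2] & s != s'] &
        [/\ kind D' s t = Some k, kind D' s' t' = Some k',
            above k b & above k' b]].

(* Three arcs in the disk, at distinct heights h1, h2, h3, any two of which
   cross exactly once.  The i-th and the j-th arc cross at the parameters
   (sij, tij) in D and (sij', tij') in D'; along each arc, the order of its two
   crossings is reversed. *)
Definition reidemeister3 (R : realType) (K : Type) (above : K -> bool -> Prop)
    (D D' : long_diagram R K) : Prop :=
  exists (B : set (plane R)) (a1 b1 a2 b2 a3 b3 : R)
      (s12 t12 s13 t13 s23 t23 s12' t12' s13' t13' s23' t23' : R)
      (k12 k13 k23 : K) (h1 h2 h3 : nat),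
    [/\ [/\ a1 < b1, b1 < a2, a2 < b2, b2 < a3 & a3 < b3],
        agree_outside B (`[a1, b1] `|` `[a2, b2] `|` `[a3, b3]) D D',
        [/\ crossings_in D B = [set (s12, t12); (s13, t13); (s23, t23)],
            [/\ s12 \in `[a1, b1], s13 \in `[a1, b1] & s23 \in `[a2, b2]],
            [/\ t12 \in `[a2, b2], t13 \in `[a3, b3] & t23 \in `[a3, b3]] &
            [/\ kind D s12 t12 = Some k12, kind D s13 t13 = Some k13 &
                kind D s23 t23 = Some k23]],
        [/\ crossings_in D' B =
              [set (s12', t12'); (s13', t13'); (s23', t23')],
            [/\ s12' \in `[a1, b1], s13' \in `[a1, b1] & s23' \in `[a2, b2]],
            [/\ t12' \in `[a2, b2], t13' \in `[a3, b3] & t23' \in `[a3, b3]] &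
            [/\ kind D' s12' t12' = Some k12, kind D' s13' t13' = Some k13 &
                kind D' s23' t23' = Some k23]] &
        [/\ [/\ (s12 < s13) = (s13' < s12'), (t12 < s23) = (s23' < t12') &
                (t13 < t23) = (t23' < t13')],
            uniq [:: h1; h2; h3],
            above k12 (h2 < h1)%N, above k13 (h3 < h1)%N &
            above k23 (h3 < h2)%N]].

Inductive move (R : realType) (K : Type) (above : K -> bool -> Prop)
    (D D' : long_diagram R K) : Prop :=
  | MovePlanar of planar_isotopy D D'
  | MoveDetour of detour D D'
  | MoveR1 of reidemeister1 D D'
  | MoveR2 of reidemeister2 above D D'
  | MoveR3 of reidemeister3 above D D'.

Definition flat_isotopic (R : realType) (S T : long_flat_virtual_diagram R) :
    Prop := clos_refl_sym_trans _ (@move R unit flat_above) S T.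

Definition virtual_isotopic (R : realType) (D E : long_virtual_diagram R) :
    Prop := clos_refl_sym_trans _ (@move R upper_strand classical_above) D E.

(** * Isotopy classes *)

Definition classes (X : Type) (e : X -> X -> Prop) : Type :=
  {C : set X | exists x, C = [set y | e x y]}.

Definition class_of (X : Type) (e : X -> X -> Prop) (x : X) : classes e :=
  exist _ [set y | e x y] (ex_intro _ x erefl).

Definition long_flat_virtual_knot (R : realType) := classes (@flat_isotopic R).

Definition long_virtual_knot (R : realType) := classes (@virtual_isotopic R).

(** * The ascending diagram *)

Definition ascending (R : realType) (S : long_flat_virtual_diagram R) :
    long_virtual_diagram R :=
  LongDiagram (fun s t => omap (fun _ : unit => SecondOver) (kind S s t))
    (curve_generic S).

(* Main.v *)
Require Import Defs.

(** Decorating every flat crossing with [SecondOver] turns each flat move into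
    a virtual move: in a second or third Reidemeister move, the arcs in the
    disk get heights that increase in the order in which they are traversed.
    Forgetting the decorations turns each virtual move into a flat move and is
    a left inverse of the ascending diagram, whence injectivity. *)

Set Implicit Arguments.
Unset Strict Implicit.
Unset Printing Implicit Defensive.

(** Common form of [ascending] and of its left inverse. The curve is kept, so all conditions on
    disks, parameters and crossings carry over as they stand. *)
Definition map_kind (R : realType) (K L : Type) (f : K -> L)
    (D : long_diagram R K) : long_diagram R L :=
  LongDiagram (fun s t => omap f (kind D s t)) (curve_generic D).

Lemma clos_rst_map (X Y : Type) (r : X -> X -> Prop) (q : Y -> Y -> Prop)
    (f : X -> Y) :
  (forall x y, r x y -> q (f x) (f y)) ->
  forall x y, clos_refl_sym_trans X r x y ->
    clos_refl_sym_trans Y q (f x) (f y).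
Proof.
move=> rq x y; elim=> {x y} [x y /rq|x|x y _|x y z _ xy _]; last 1 first.
- exact: rst_trans xy.
- exact: rst_step.
- exact: rst_refl.
- exact: rst_sym.
Qed.

Section MapKind.
Context (R : realType) (K L : Type) (f : K -> L).
Implicit Types D : long_diagram R K.

Lemma map_kind_Some D s t k :
  kind D s t = Some k -> kind (map_kind f D) s t = Some (f k).
Proof. by move=> /= ->. Qed.

Lemma map_kind_agree_outside B U D D' :
  agree_outside B U D D' ->
  agree_outside B U (map_kind f D) (map_kind f D').
Proof.
move=> [dB DU D'U cE kE]; split=> // s t st Bs /=.
by rewrite kE.
Qed.

Lemma map_kind_planar_isotopy D D' :
  planar_isotopy D D' -> planar_isotopy (map_kind f D) (map_kind f D').
Proof.
move=> [h [r [hh rr cE kE]]]; exists h, r; split=> // s t st /=.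
by rewrite kE.
Qed.

(** [omap] fixes [None], so virtual crossings stay virtual. *)
Lemma map_kind_detour D D' :
  detour D D' -> detour (map_kind f D) (map_kind f D').
Proof.
move=> [a [b [ab cE vD vD' kE]]]; exists a, b; split=> // s t st /= *.
- by rewrite vD.
- by rewrite vD'.
- by rewrite kE.
Qed.

Lemma map_kind_reidemeister1 D D' :
  reidemeister1 D D' -> reidemeister1 (map_kind f D) (map_kind f D').
Proof.
move=> [B [a [b [s [t [k [ab agr c0 c1 kE]]]]]]].
exists B, a, b, s, t, (f k); split=> //.
- exact: map_kind_agree_outside.
- exact: map_kind_Some.
Qed.

Context (above : K -> bool -> Prop) (above' : L -> bool -> Prop).

(** The order of the strands may change under [f]: a flat move is valid for any order, while its
    ascending image dictates one. *)
Hypothesis above2 : forall k k' b, above k b -> above k' b ->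
  exists b', above' (f k) b' /\ above' (f k') b'.

(** As for [above2], but the three new relations must come from one total order of the arcs, hence
    new heights. *)
Hypothesis above3 : forall k12 k13 k23 (h1 h2 h3 : nat),
  uniq [:: h1; h2; h3] ->
  above k12 (h2 < h1)%N -> above k13 (h3 < h1)%N -> above k23 (h3 < h2)%N ->
  exists h1' h2' h3' : nat,
    [/\ uniq [:: h1'; h2'; h3'], above' (f k12) (h2' < h1')%N,
        above' (f k13) (h3' < h1')%N & above' (f k23) (h3' < h2')%N].

Lemma map_kind_reidemeister2 D D' :
  reidemeister2 above D D' ->
  reidemeister2 above' (map_kind f D) (map_kind f D').
Proof.
move=> [B [a1 [b1 [a2 [b2 [s [t [s' [t' [k [k' [b []]]]]]]]]]]]].
move=> [ab1 b1a2 ab2 agr] c0 c2 st [kE kE' kb k'b].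
have [b' [kb' k'b']] := above2 kb k'b.
exists B, a1, b1, a2, b2, s, t, s', t', (f k), (f k'), b'; split=> //.
- by split=> //; exact: map_kind_agree_outside.
- by split=> //; exact: map_kind_Some.
Qed.

Lemma map_kind_reidemeister3 D D' :
  reidemeister3 above D D' ->
  reidemeister3 above' (map_kind f D) (map_kind f D').
Proof.
move=> [B [a1 [b1 [a2 [b2 [a3 [b3 [s12 [t12 [s13 [t13 [s23 [t23]]]]]]]]]]]]].
move=> [s12' [t12' [s13' [t13' [s23' [t23' [k12 [k13 [k23 [h1 [h2 [h3]]]]]]]]]]]].
move=> [ab agr [cD sD tD [k12E k13E k23E]]].
move=> [cD' sD' tD' [k12E' k13E' k23E']] [ord uh a12 a13 a23].
have [h1' [h2' [h3' [uh' a12' a13' a23']]]] := above3 uh a12 a13 a23.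
exists B, a1, b1, a2, b2, a3, b3, s12, t12, s13, t13, s23, t23.
exists s12', t12', s13', t13', s23', t23', (f k12), (f k13), (f k23).
exists h1', h2', h3'; split=> //.
- exact: map_kind_agree_outside.
- by split=> //; split; exact: map_kind_Some.
- by split=> //; split; exact: map_kind_Some.
Qed.

Lemma map_kind_move D D' :
  move above D D' -> move above' (map_kind f D) (map_kind f D').
Proof.
case.
- by move=> /map_kind_planar_isotopy; exact: MovePlanar.
- by move=> /map_kind_detour; exact: MoveDetour.
- by move=> /map_kind_reidemeister1; exact: MoveR1.
- by move=> /map_kind_reidemeister2; exact: MoveR2.
- by move=> /map_kind_reidemeister3; exact: MoveR3.
Qed.

End MapKind.

Lemma ascending_isotopic (R : realType) (S T : long_flat_virtual_diagram R) :
  flat_isotopic S T -> virtual_isotopic (ascending S) (ascending T).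
Proof.
apply: (clos_rst_map (f := map_kind (fun=> SecondOver))) => {}S {}T.
apply: map_kind_move => [_ _ _ _ _|_ _ _ _ _ _ _ _ _ _].
(* [false] puts the strand traversed first below, which is what [SecondOver] demands. *)
- by exists false.
(* Increasing heights make all three comparisons [false]. *)
- by exists 1%N, 2%N, 3%N.
Qed.

Definition forget_kind (R : realType) :
    long_virtual_diagram R -> long_flat_virtual_diagram R :=
  map_kind (fun=> tt).

Lemma forget_kind_isotopic (R : realType) (D E : long_virtual_diagram R) :
  virtual_isotopic D E -> flat_isotopic (forget_kind D) (forget_kind E).
Proof.
apply: clos_rst_map => {}D {}E.
apply: map_kind_move => [_ _ b _ _|_ _ _ h1 h2 h3 uh _ _ _].
- by exists b.
- by exists h1, h2, h3.
Qed.

(** An equality of diagrams, not merely an isotopy: [unit] has a single element, so [kind] is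
    recovered at all parameters, crossings or not. *)
Lemma ascendingK (R : realType) : cancel (@ascending R) (@forget_kind R).
Proof.
case=> c k cg; rewrite /forget_kind /map_kind /=; congr LongDiagram.
by apply/funext => s; apply/funext => t; case: (k s t) => [[]|].
Qed.

Section Classes.
Context (X : Type) (r : X -> X -> Prop).
Let e := clos_refl_sym_trans X r.

Lemma class_of_surj (C : classes e) : exists x, C = class_of e x.
Proof.
by case: C => C [x Cx]; exists x; exact: eq_exist.
Qed.

Lemma class_ofP x y : class_of e x = class_of e y <-> e x y.
Proof.
(* By reflexivity [y] lies in its own class, hence in that of [x]. *)
split=> [/(congr1 sval) /= /seteqP[_ /(_ y)]|xy].
  by apply; exact: rst_refl.
apply: eq_exist; apply/seteqP; split=> z /=.
- by apply: rst_trans; exact: rst_sym.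
- exact: rst_trans xy.
Qed.

End Classes.

Theorem mainTheorem1 (R : realType) :
  (forall S T : long_flat_virtual_diagram R,
     flat_isotopic S T -> virtual_isotopic (ascending S) (ascending T)) /\
  (exists A : long_flat_virtual_knot R -> long_virtual_knot R,
     (forall S : long_flat_virtual_diagram R,
        A (class_of (@flat_isotopic R) S) =
        class_of (@virtual_isotopic R) (ascending S)) /\
     injective A).
Proof.
split; first exact: ascending_isotopic.
(* Choice of a representative in each class; by the first part, the class of its ascending diagram
   does not depend on it. *)
pose rep (C : long_flat_virtual_knot R) := projT1 (cid (class_of_surj C)).
have repK C : class_of (@flat_isotopic R) (rep C) = C.
  by rewrite /rep; case: cid.
exists (fun C => class_of (@virtual_isotopic R) (ascending (rep C))).
split=> [S|C C' /class_ofP /forget_kind_isotopic].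
- by apply/class_ofP/ascending_isotopic/class_ofP; exact: repK.
(* Forgetting the decorations has turned the virtual isotopy into a flat one between the two
   representatives. *)
- by rewrite !ascendingK => /class_ofP; rewrite !repK.
Qed.
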